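(* Let $D$ be a self-adjoint operator affiliated with $\mathcal N$ having $\tau$-compact resolvent, and let $V=V^*\in\mathcal N$ be such that the operators $D+V$ and $D$ are unitarily equivalent, via a unitary in $\mathcal N$. Then the spectral shift function $\xi_{D+V,D}$ of the pair $(D+V,D)$ is constant on $\mathbb R$.
   Context: $\mathcal N$ is a semifinite von Neumann algebra acting on a separable complex Hilbert space, with a faithful normal semifinite trace $\tau$. $\mathcal K(\mathcal N,\tau)$ is the ideal of $\tau$-compact operators, i.e. the norm closure of the ideal of $\mathcal N$ generated by projections of finite trace. A self-adjoint operator $D$ affiliated with $\mathcal N$ has $\tau$-compact resolvent if $(z-D)^{-1}\in\mathcal K(\mathcal N,\tau)$ for some (equivalently all) $z\in\mathbb C\setminus\mathbb R$. $E^D_\Delta$ denotes the spectral projection of $D$ for a Borel set $\Delta$; it has finite trace if $\Delta$ is bounded and $D$ has $\tau$-compact resolvent (a property stable under bounded self-adjoint perturbations from $\mathcal N$). Spectral shift function of $D_0$ and $D_1=D_0+V$: with $D_r=D_0+rV$, the spectral shift measure is $\Xi_{D_1,D_0}(\Delta)=\int_0^1\tau(VE^{D_r}_\Delta)\,dr$ for bounded Borel $\Delta\subset\mathbb R$. It is absolutely continuous with respect to Lebesgue measure, and its density coincides almost everywhere with $\lambda\mapsto\tau(E^{D_0}_{(a,\lambda]})-\tau(E^{D_1}_{(a,\lambda]})+\mathrm{const}$ for any fixed $a\in\mathbb R$ and a suitable constant (where $\tau(E^{D}_{(a,\lambda]})$ means $-\tau(E^{D}_{(\lambda,a]})$ if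 $\lambda<a$). The spectral shift function $\xi_{D_1,D_0}$ is the everywhere defined representative of the density equal to this expression at its continuity points and to the half-sum of its left and right limits at its discontinuity points. *)

(* Defs.v *)
From HB Require Import structures.
From mathcomp Require Import all_boot all_order all_algebra.
From mathcomp Require Import sesquilinear complex.
From mathcomp Require Import all_classical all_reals all_analysis.
Import Order.TTheory GRing.Theory Num.Theory.
Import numFieldNormedType.Exports.

Set Implicit Arguments.
Unset Strict Implicit.
Unset Printing Implicit Defensive.

Local Open Scope classical_set_scope.
Local Open Scope ring_scope.

(* Throughout, H is a complex Hilbert space: a Banach space over R[i] whose
   norm comes from the inner product dot (linear in its first argument); the
   compatibility of norm and inner product is the predicate hilbert_norm.
   Everywhere defined operators are plain functions H -> H; operators that need
   not be everywhere defined have type operator H. *)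

Section BoundedOperators.
Context {R : realType} {H : completeNormedModType R[i]}.
Variable dot : {dot H for Num.conj}.

Definition hilbert_norm : Prop := forall x : H, `|x| ^+ 2 = dot x x.

Definition separable : Prop := exists2 S : set H, countable S & dense S.

Definition bounded_operator (T : H -> H) : Prop := linear T /\ continuous T.

Definition is_adjoint (T S : H -> H) : Prop :=
  forall x y, dot (T x) y = dot x (S y).

Definition is_projection (P : H -> H) : Prop :=
  [/\ bounded_operator P, P \o P = P & is_adjoint P P].

Definition unitary_with_adjoint (U Us : H -> H) : Prop :=
  [/\ bounded_operator U, bounded_operator Us, is_adjoint U Us,
      Us \o U = id & U \o Us = id].

Definition commutant (N : set (H -> H)) : set (H -> H) :=
  [set T | bounded_operator T /\ forall S, N S -> T \o S = S \o T].

(* Being a bicommutant makes N a unital algebra of bounded operators. *)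
Record von_neumann_algebra (N : set (H -> H)) : Prop := {
  vna_star : forall T, N T -> exists2 S, N S & is_adjoint T S;
  vna_bicommutant : commutant (commutant N) = N
}.

(* The order of R[i] is the partial one: 0 <= z entails that z is real. *)
Definition positive_cone (N : set (H -> H)) : set (H -> H) :=
  [set T | N T /\ forall x, 0 <= dot (T x) x].

Definition operator_le (S T : H -> H) : Prop :=
  forall x, dot (S x) x <= dot (T x) x.

(* Upward directed families of operators; suprema of positive families are
   taken among the self-adjoint elements of N. *)
Definition directed_up (F : set (H -> H)) : Prop :=
  F !=set0 /\ forall S T, F S -> F T ->
    exists W, [/\ F W, operator_le S W & operator_le T W].

Definition is_supremum (N F : set (H -> H)) (T : H -> H) : Prop :=
  [/\ N T, is_adjoint T T, (forall S, F S -> operator_le S T) &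
      forall W, N W -> is_adjoint W W -> (forall S, F S -> operator_le S W) ->
        operator_le T W].

(* Only the values of tau on the positive cone of N are relevant. *)
Record faithful_normal_semifinite_trace
    (N : set (H -> H)) (tau : (H -> H) -> \bar R) : Prop := {
  trace_ge0 : forall T, positive_cone N T -> (0 <= tau T)%E;
  traceD : forall S T, positive_cone N S -> positive_cone N T ->
    tau (S \+ T) = (tau S + tau T)%E;
  traceZ : forall (a : R) T, 0 <= a -> positive_cone N T ->
    tau (fun x => a%:C%C *: T x) = (a%:E * tau T)%E;
  trace_tracial : forall T S, N T -> N S -> is_adjoint T S ->
    tau (S \o T) = tau (T \o S);
  trace_faithful : forall T, positive_cone N T -> tau T = 0%E ->
    T = (fun=> 0);
  trace_normal : forall F T, F `<=` positive_cone N -> directed_up F ->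
    is_supremum N F T -> tau T = ereal_sup (tau @` F);
  trace_semifinite : forall T, positive_cone N T -> T <> (fun=> 0) ->
    exists S, [/\ positive_cone N S, S <> (fun=> 0), operator_le S T &
                  (tau S < +oo)%E]
}.

(* Linear extension of tau to the span of the positive elements of finite
   trace; the value is 0 outside that span. *)
Definition has_trace (N : set (H -> H)) (tau : (H -> H) -> \bar R)
    (T : H -> H) (z : R[i]) : Prop :=
  exists A : 'I_4 -> H -> H,
    [/\ forall k, positive_cone N (A k) /\ (tau (A k) < +oo)%E,
        forall x, T x = \sum_(k < 4) 'i%C ^+ k *: A k x &
        z = \sum_(k < 4) 'i%C ^+ k * (fine (tau (A k)))%:C%C].

Definition linear_trace (N : set (H -> H)) (tau : (H -> H) -> \bar R)
    (T : H -> H) : R[i] := xget 0 [set z | has_trace N tau T z].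

Definition finite_projections (N : set (H -> H)) (tau : (H -> H) -> \bar R) :
    set (H -> H) :=
  [set P | [/\ N P, is_projection P & (tau P < +oo)%E]].

(* Closure under scalars is the case where T is a multiple of the identity. *)
Definition two_sided_ideal (N J : set (H -> H)) : Prop :=
  [/\ J `<=` N, J (fun=> 0), (forall S T, J S -> J T -> J (S \+ T)) &
      forall T S, N T -> J S -> J (T \o S) /\ J (S \o T)].

Definition tau_compact (N : set (H -> H)) (tau : (H -> H) -> \bar R) :
    set (H -> H) :=
  [set T | bounded_operator T /\ forall eps : R, 0 < eps ->
    exists2 S, smallest (two_sided_ideal N) (finite_projections N tau) S &
      forall x, `|T x - S x| <= eps%:C%C * `|x|].

End BoundedOperators.

(* The values of opfun outside opdom are irrelevant. *)
Record operator (H : Type) := Operator { opdom : set H; opfun : H -> H }.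

Section UnboundedOperators.
Context {R : realType} {H : completeNormedModType R[i]}.
Variable dot : {dot H for Num.conj}.

Definition add_bounded (D : operator H) (W : H -> H) : operator H :=
  Operator (opdom D) (fun x => opfun D x + W x).

(* The last clause says that D and its adjoint have the same graph. *)
Record self_adjoint (D : operator H) : Prop := {
  sa_dense : dense (opdom D);
  sa_dom0 : opdom D 0;
  sa_dom_linear : forall (a : R[i]) x y, opdom D x -> opdom D y ->
    opdom D (a *: x + y);
  sa_linear : forall (a : R[i]) x y, opdom D x -> opdom D y ->
    opfun D (a *: x + y) = a *: opfun D x + opfun D y;
  sa_adjoint : forall y z,
    (forall x, opdom D x -> dot (opfun D x) y = dot x z) <->
    (opdom D y /\ opfun D y = z)
}.

(* The commutant contains the inverses of its unitaries, so the inclusion of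
   domains required here is an equality. *)
Definition affiliated (N : set (H -> H)) (D : operator H) : Prop :=
  forall U Us, commutant N U -> unitary_with_adjoint dot U Us ->
    forall x, opdom D x -> opdom D (U x) /\ opfun D (U x) = U (opfun D x).

Definition is_resolvent (D : operator H) (z : R[i]) (T : H -> H) : Prop :=
  (forall x, opdom D (T x) /\ z *: T x - opfun D (T x) = x) /\
  (forall x, opdom D x -> T (z *: x - opfun D x) = x).

Definition tau_compact_resolvent (N : set (H -> H))
    (tau : (H -> H) -> \bar R) (D : operator H) : Prop :=
  exists (z : R[i]) (T : H -> H),
    [/\ complex.Im z != 0, is_resolvent D z T & tau_compact dot N tau T].

Definition unitarily_equivalent_in (N : set (H -> H)) (D1 D0 : operator H) :
    Prop :=
  exists U Us, [/\ N U, unitary_with_adjoint dot U Us,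
    (forall x, opdom D1 x <-> opdom D0 (Us x)) &
    forall x, opdom D1 x -> opfun D1 x = U (opfun D0 (Us x))].

Record projection_valued_measure (E : set R -> H -> H) : Prop := {
  pvm_projection : forall A : set (measurableTypeR R), measurable A ->
    is_projection dot (E A);
  pvm_setT : E setT = id;
  pvm_setI : forall A B : set (measurableTypeR R),
    measurable A -> measurable B -> E (A `&` B) = E A \o E B;
  pvm_sigma_additive : forall F : (set (measurableTypeR R))^nat,
    (forall i, measurable (F i)) -> trivIset setT F ->
    forall x : H, (fun n => \sum_(i < n) E (F i) x) @ \oo -->
                  E (\bigcup_i F i) x
}.

(* D is the integral of the identity against E. For each x, the measure mu is
   A |-> <E(A)x, x>; by polarization, its integrals determine <Dx, y>. *)
Definition is_spectral_measure (D : operator H) (E : set R -> H -> H) : Prop :=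
  projection_valued_measure E /\
  forall x, exists mu : {measure set (measurableTypeR R) -> \bar R},
    [/\ forall A : set (measurableTypeR R), measurable A ->
          mu A = (complex.Re (dot (E A x) x))%:E,
        opdom D x <-> (\int[mu]_l (l ^+ 2)%:E < +oo)%E &
        opdom D x ->
          dot (opfun D x) x = (Rintegral mu setT (fun l : R => l))%:C%C].

(* For a self-adjoint D this is its spectral measure, which exists and is
   unique on Borel sets by the spectral theorem. *)
Definition spectral_projection (D : operator H) : set R -> H -> H :=
  xget (fun _ _ => 0) [set E | is_spectral_measure D E].

(* The trace of V E is real when V is self-adjoint. *)
Definition spectral_shift_measure (N : set (H -> H))
    (tau : (H -> H) -> \bar R) (D : operator H) (V : H -> H) (A : set R) : R :=
  Rintegral (@lebesgue_measure R) `[0, 1] (fun r : R =>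
    complex.Re (linear_trace dot N tau
      (V \o spectral_projection
              (add_bounded D (fun x => r%:C%C *: V x)) A))).

(* The trace of the spectral projection of ]a, l], with the sign convention of
   oriented integrals. *)
Definition spectral_counting (tau : (H -> H) -> \bar R) (D : operator H)
    (a l : R) : R :=
  if a <= l then fine (tau (spectral_projection D `]a, l]))
  else - fine (tau (spectral_projection D `]l, a])).

(* The spectral shift function of the pair (D + V, D). *)
Definition is_spectral_shift_function (N : set (H -> H))
    (tau : (H -> H) -> \bar R) (D : operator H) (V : H -> H) (xi : R -> R) :
    Prop :=
  (forall A : set (measurableTypeR R), measurable A ->
     bounded_set (A : set R) ->
     (@lebesgue_measure R).-integrable A (EFin \o xi) /\
     spectral_shift_measure N tau D V A =
       Rintegral (@lebesgue_measure R) A xi) /\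
  (forall a : R, exists c : R,
     let g := fun l : R => spectral_counting tau D a l
                           - spectral_counting tau (add_bounded D V) a l + c in
     forall l : R,
       ({for l, continuous g} -> xi l = g l) /\
       (~ {for l, continuous g} -> exists gl gr : R,
          [/\ g x @[x --> l^'-] --> gl, g x @[x --> l^'+] --> gr &
              xi l = (gl + gr) / 2])).

End UnboundedOperators.

(* Main.v *)
From HB Require Import structures.
Require Import Defs.
From mathcomp Require Import all_boot all_order all_algebra.
From mathcomp Require Import sesquilinear complex.
From mathcomp Require Import all_classical all_reals all_analysis.
From mathcomp Require Import measurable_realfun ring lra.
Import Order.TTheory GRing.Theory Num.Theory.
Import numFieldNormedType.Exports.

(* By the half-sum description of xi, it suffices that D and D + V = U D U^* have
   spectral projections of the same trace on bounded intervals ]a, b]. By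
   uniqueness of spectral measures the projection of D + V is U E(]a, b]) U^*, and
   traciality gives the claim as soon as E(]a, b]) lies in N. Uniqueness also shows
   that E(]a, b]) commutes with the unitaries of the commutant of N, which fix D;
   as the Cayley transforms of the self-adjoint elements of the commutant are
   among them, E(]a, b]) is in the bicommutant, N.

   Uniqueness of the spectral measure is proved without functional calculus. If E
   and F are spectral measures of D, then D - c is bounded by r on the range of
   E[c - r, c + r] and bounded below by s > r on that of F[c + s, +oo[. Applying
   (D - c)^n to the F-part of a vector x of the first range gives
   s^n |F x| <= r^n |x| for all n, so the two ranges are orthogonal.

   If D had no spectral measure at all, neither would D + V, and both chosen
   families of projections would be the same default. *)

Set Implicit Arguments.
Unset Strict Implicit.
Unset Printing Implicit Defensive.
Local Open Scope classical_set_scope.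
Local Open Scope ring_scope.
Local Notation Re := complex.Re.
Local Notation Im := complex.Im.

(** * The real inner product *)

Section LinearMaps.
Context {K : pzRingType} {U W : lmodType K} (T : U -> W) (T_lin : linear T).

Lemma linear_fun0 : T 0 = 0.
Proof. by have := T_lin (-1) 0 0; rewrite scaleN1r oppr0 addr0 scaleN1r addNr. Qed.

Lemma linear_funZ a x : T (a *: x) = a *: T x.
Proof. by have := T_lin a x 0; rewrite !addr0 linear_fun0 addr0. Qed.

Lemma linear_funD x y : T (x + y) = T x + T y.
Proof. by have := T_lin 1 x y; rewrite !scale1r. Qed.

Lemma linear_funB x y : T (x - y) = T x - T y.
Proof. by rewrite linear_funD -scaleN1r linear_funZ scaleN1r. Qed.

End LinearMaps.

Section ComplexNumbers.
Context {R : realType}.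
Implicit Types z : R[i].

Lemma Re_conj z : Re (Num.conj z) = Re z.
Proof. by case: z. Qed.

Lemma Im_conj z : Im (Num.conj z) = - Im z.
Proof. by case: z. Qed.

Lemma ReZ (r : R) z : Re (r%:C%C * z) = r * Re z.
Proof. by case: z => a b /=; rewrite mul0r subr0. Qed.

Lemma Re_imul z : Re ('i%C * z) = - Im z.
Proof. by rewrite mulrC ReiNIm. Qed.

Lemma Im_imul z : Im ('i%C * z) = Re z.
Proof. by rewrite mulrC ImiRe. Qed.

End ComplexNumbers.

Section RealInnerProduct.
Context {R : realType} {H : completeNormedModType R[i]}.
Variable dot : {dot H for Num.conj}.

(* The real inner product underlying dot; it determines dot, because
   Im <x, y> = - Re <i x, y>. *)
Definition rdot (x y : H) : R := Re (dot x y).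

Lemma rdotC x y : rdot x y = rdot y x.
Proof. by rewrite /rdot [dot x y]hermC expr0 mul1r Re_conj. Qed.

Lemma rdotDl x y z : rdot (x + y) z = rdot x z + rdot y z.
Proof. by rewrite /rdot linearDl raddfD. Qed.

Lemma rdotDr x y z : rdot z (x + y) = rdot z x + rdot z y.
Proof. by rewrite rdotC rdotDl !(rdotC z). Qed.

Lemma rdotZl (r : R) x y : rdot (r%:C%C *: x) y = r * rdot x y.
Proof. by rewrite /rdot linearZl_LR ReZ. Qed.

Lemma rdotZr (r : R) x y : rdot y (r%:C%C *: x) = r * rdot y x.
Proof. by rewrite rdotC rdotZl rdotC. Qed.

Lemma rdotNl x y : rdot (- x) y = - rdot x y.
Proof. by rewrite /rdot linearNl raddfN. Qed.

Lemma rdotNr x y : rdot y (- x) = - rdot y x.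
Proof. by rewrite rdotC rdotNl rdotC. Qed.

Lemma rdotBl x y z : rdot (x - y) z = rdot x z - rdot y z.
Proof. by rewrite rdotDl rdotNl. Qed.

Lemma rdotBr x y z : rdot z (x - y) = rdot z x - rdot z y.
Proof. by rewrite rdotDr rdotNr. Qed.

Definition rdotE := (rdotDl, rdotDr, rdotNl, rdotNr, rdotZl, rdotZr).

Lemma rdotil x y : rdot ('i%C *: x) y = - Im (dot x y).
Proof. by rewrite /rdot linearZl_LR Re_imul. Qed.

Lemma rdot0l x : rdot 0 x = 0.
Proof. by rewrite /rdot linear0l. Qed.

Lemma rdot0r x : rdot x 0 = 0.
Proof. by rewrite rdotC rdot0l. Qed.

Lemma dot_real x : dot x x = (rdot x x)%:C%C.
Proof. by rewrite /rdot RRe_real // ger0_real ?dnorm_ge0. Qed.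

Lemma rdot_ge0 x : 0 <= rdot x x.
Proof. by rewrite -ler0c -dot_real dnorm_ge0. Qed.

Lemma rdot_eq0 x : rdot x x = 0 -> x = 0.
Proof. by move=> x0; apply/eqP; rewrite -(dnorm_eq0 dot) dot_real x0. Qed.

Lemma rdot_inj x y : (forall z, rdot x z = rdot y z) -> x = y.
Proof.
move=> e; apply/eqP; rewrite -subr_eq0; apply/eqP/rdot_eq0.
by rewrite rdotBl e subrr.
Qed.

Lemma dot_rdot x y x' y' : rdot x y = rdot x' y' ->
  rdot ('i%C *: x) y = rdot ('i%C *: x') y' -> dot x y = dot x' y'.
Proof.
rewrite !rdotil => e1 /oppr_inj e2.
by apply/eqP; rewrite eq_complex; apply/andP; split; apply/eqP.
Qed.

Lemma rdot_CauchySchwarz x y : rdot x y ^+ 2 <= rdot x x * rdot y y.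
Proof.
have [x0|/eqP x0] := eqVneq (rdot x x) 0.
  by rewrite (rdot_eq0 x0) !rdot0l expr0n mul0r.
have xp : 0 < rdot x x by rewrite lt_neqAle rdot_ge0 eq_sym andbT; apply/eqP.
(* This vector is |x|^2 times the component of [y] orthogonal to [x]; its squared norm is |x|^2
   (|x|^2 |y|^2 - <x, y>^2). *)
have := rdot_ge0 ((- rdot x y)%:C%C *: x + (rdot x x)%:C%C *: y).
rewrite !rdotE (rdotC y x) => h.
rewrite -subr_ge0 -(pmulr_rge0 _ xp); move: h; congr (_ <= _); ring.
Qed.

End RealInnerProduct.

(** * Bounded operators and the Riesz-Lax-Milgram theorem *)

Section BoundedOperatorBounds.
Context {R : realType} {H : completeNormedModType R[i]}.
Variable dot : {dot H for Num.conj}.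
Hypothesis Hnorm : hilbert_norm dot.

Local Notation "'[ x , y ]" := (rdot dot x y).

Lemma gt0_complex_real (e : R[i]) : 0 < e -> e = (Re e)%:C%C /\ 0 < Re e.
Proof. by case: e => a b; rewrite ltcE /= => /andP[/eqP -> ->]. Qed.

Lemma norm_rdot x : `|x| = (Num.sqrt '[x, x])%:C%C.
Proof.
apply/eqP; rewrite -(@eqrXn2 _ 2) ?normr_ge0 ?ler0c ?sqrtr_ge0 //.
by rewrite Hnorm dot_real -rmorphXn /= sqr_sqrtr ?rdot_ge0.
Qed.

Lemma norm_lt_rdot x (e : R) : 0 < e -> (`|x| < e%:C%C) = ('[x, x] < e ^+ 2).
Proof.
move=> e0; rewrite norm_rdot ltcR -(@ltr_pXn2r _ 2) ?nnegrE ?sqrtr_ge0 ?ltW //.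
by rewrite sqr_sqrtr ?rdot_ge0.
Qed.

Lemma cvg_rdot (u : nat -> H) (l : H) : u @ \oo --> l ->
  forall e : R, 0 < e -> \forall n \near \oo, '[l - u n, l - u n] < e.
Proof.
move=> /cvgrPdist_lt ul e e0; have s0 : 0 < Num.sqrt e by rewrite sqrtr_gt0.
have := ul (Num.sqrt e)%:C%C; rewrite ltcR => /(_ s0).
by apply: filterS => n /=; rewrite norm_lt_rdot // sqr_sqrtr // ltW.
Qed.

(** The later estimates all concern squared norms, so [C] bounds the square of the operator norm. *)
Lemma bounded_operator_rdot (T : H -> H) : bounded_operator T ->
  exists2 C : R, 0 <= C & forall x, '[T x, T x] <= C * '[x, x].
Proof.
move=> [Tl Tc]; pose f : {linear H -> H} :=
  HB.pack T (GRing.isLinear.Build _ _ _ _ T Tl).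
have /linear_boundedP : bounded_near f (nbhs 0) by apply/linear_bounded_continuous.
move=> /pinfty_ex_gt0[M /gt0_complex_real[-> M0] fM].
exists (Re M ^+ 2); first exact: sqr_ge0.
move=> x; have := fM x.
rewrite /f /= !norm_rdot -rmorphM lecR -(@ler_pXn2r _ 2) ?nnegrE ?sqrtr_ge0 //.
  by rewrite exprMn !sqr_sqrtr ?rdot_ge0.
by rewrite mulr_ge0 ?sqrtr_ge0 ?ltW.
Qed.

Lemma rdot_bounded_operator (C : R) (T : H -> H) : linear T ->
  (forall x, '[T x, T x] <= C * '[x, x]) -> bounded_operator T.
Proof.
move=> Tl TC; split=> //; pose f : {linear H -> H} :=
  HB.pack T (GRing.isLinear.Build _ _ _ _ T Tl).
apply/(linear_bounded_continuous f)/linear_boundedP.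
(* The sign of [C] is not prescribed, hence the absolute value under the root. *)
exists (Num.sqrt `|C|)%:C%C; split.
  by rewrite ger0_real // ler0c sqrtr_ge0.
move=> r rC x; apply: (@le_trans _ _ ((Num.sqrt `|C|)%:C%C * `|x|)).
  rewrite !norm_rdot -rmorphM lecR -sqrtrM // ler_wsqrtr //.
  by apply: (le_trans (TC x)); rewrite ler_wpM2r ?rdot_ge0 ?ler_norm.
by rewrite ler_wpM2r // ltW.
Qed.

Lemma bounded_operator_scale_add (a b : R[i]) (S T : H -> H) :
  bounded_operator S -> bounded_operator T ->
  bounded_operator (fun x => a *: S x + b *: T x).
Proof.
move=> [Sl Sc] [Tl Tc]; split.
  move=> c x y; rewrite Sl Tl !scalerDr !scalerA ![_ * c]mulrC addrACA.
  by rewrite -!scalerA -scalerDr.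
move=> x; apply: cvgD; apply: cvgZr; [exact: Sc|exact: Tc].
Qed.

Lemma bounded_operator_comp (S T : H -> H) :
  bounded_operator S -> bounded_operator T -> bounded_operator (S \o T).
Proof.
move=> [Sl Sc] [Tl Tc]; split; first by move=> c x y /=; rewrite Tl Sl.
by move=> x; apply: continuous_comp; [exact: Tc|exact: Sc].
Qed.

Lemma bounded_operator_id : bounded_operator (id : H -> H).
Proof. by split=> // x; exact: cvg_id. Qed.

End BoundedOperatorBounds.

Section RieszRepresentation.
Context {R : realType} {H : completeNormedModType R[i]}.
Variable dot : {dot H for Num.conj}.
Hypothesis Hnorm : hilbert_norm dot.

Local Notation "'[ x , y ]" := (rdot dot x y).

(* The solution minimizes the convex functional <B x, x> - 2 f x. *)
Lemma lax_milgram_symmetric (B : H -> H) (C : R) (f : H -> R) (Cf : R) :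
  linear B -> (forall x y, '[B x, y] = '[x, B y]) ->
  (forall x, '[B x, B x] <= C * '[x, x]) ->
  (forall x, '[x, x] <= '[B x, x]) ->
  (forall x y, f (x + y) = f x + f y) ->
  (forall (r : R) x, f (r%:C%C *: x) = r * f x) ->
  0 <= Cf -> (forall x, f x ^+ 2 <= Cf * '[x, x]) ->
  exists x0, forall h, f h = '[B x0, h].
Proof.
move=> Bl Bs BC B1 fD fZ Cf0 fC.
have BD := linear_funD Bl; have BZ := linear_funZ Bl.
pose J x := '[B x, x] - 2 * f x.
have Jge x : - Cf <= J x.
  have q0 := rdot_ge0 dot x; have := fC x; have := B1 x; rewrite /J.
  set q := '[x, x] in q0 *; move=> q1 q2.
  (* The arithmetic-geometric mean inequality: 4 (f x)^2 <= 4 Cf q <= (q + Cf)^2. *)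
  suff : 2 * f x <= q + Cf by lra.
  rewrite leNgt; apply/negP => h; have := sqr_ge0 (q - Cf).
  have s0 : 0 < 2 * f x - q - Cf by lra.
  have := mulr_ge0 (ltW s0) q0; have := mulr_ge0 (ltW s0) Cf0.
  have := mulr_gt0 s0 s0; lra.
have hJ : has_inf (range J).
  by split; [exists (J 0), 0 | exists (- Cf) => _ [x _ <-]].
pose m := inf (range J).
have Jm x : m <= J x by have /lbP := ge_inf hJ.2; apply; exists x.
pose e (n : nat) : R := n.+1%:R^-1.
have e0 n : 0 < e n by rewrite invr_gt0 ltr0n.
have /choice[u uP] : forall n, exists x, J x < m + e n.
  by move=> n; have [_ [x _ <-] xm] := inf_adherent (e0 n) hJ; exists x.
have Jt x h t : J (x + t%:C%C *: h) =
    J x + 2 * t * ('[B x, h] - f h) + t ^+ 2 * '[B h, h].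
  by rewrite /J BD BZ fD fZ !rdotE (Bs h x) (rdotC _ h (B x)); ring.
have b0 h : 0 <= '[B h, h] by apply: le_trans (B1 h); exact: rdot_ge0.
(* Approximate Euler equation. Since [J] stays above [m] and [J (u n)] is below [m + e n], a
   quadratic polynomial in [t] is nonnegative; its discriminant bounds [d], half the derivative of
   [J] at [u n] along [h]. *)
have dP n h : ('[B (u n), h] - f h) ^+ 2 <= e n * '[B h, h].
  set d := _ - _; have hP t : 0 <= e n + 2 * t * d + t ^+ 2 * '[B h, h].
    by have := Jm (u n + t%:C%C *: h); have := uP n; rewrite Jt -/d; lra.
  (* If the quadratic term vanishes, the polynomial is affine and would equal [- e n] at
     [t = - e n / d]. Otherwise it is evaluated at its minimum. *)
  have [bh|bh] := eqVneq '[B h, h] 0.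
    rewrite bh mulr0 leNgt; apply/negP => d2.
    have := hP (- e n / d); rewrite bh mulr0 addr0.
    have d0 : d != 0 by apply: contraTneq d2 => ->; rewrite expr0n ltxx.
    have -> : 2 * (- e n / d) * d = - (2 * e n) by field.
    by have := e0 n; lra.
  have := hP (- d / '[B h, h]).
  have bp : 0 < '[B h, h] by rewrite lt_neqAle eq_sym bh b0.
  have -> : e n + 2 * (- d / '[B h, h]) * d + (- d / '[B h, h]) ^+ 2 * '[B h, h]
    = (e n * '[B h, h] - d ^+ 2) / '[B h, h] by field.
  by rewrite pmulr_lge0 ?invr_gt0 // subr_ge0.
(* Parallelogram identity for the form of [B]: the value of [J] at the midpoint of [u n] and [u k]
   is at least [m]. *)
have dist n k : '[u n - u k, u n - u k] <= 2 * (e n + e k).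
  apply: (le_trans (B1 _)).
  have := Jm (2^-1%:C%C *: (u n + u k)); have := uP n; have := uP k.
  rewrite /J BZ (linear_funB Bl) BD fZ fD !rdotE (Bs (u k) (u n)) (rdotC _ (u k)).
  by lra.
have [x0 ux0] : exists x0 : H, u @ \oo --> x0.
  apply/cvg_ex; apply/cauchy_cvgP/cauchy_exP => eps /gt0_complex_real[-> eps0].
  set d := Re eps in eps0 *.
  (* For [k] beyond [n] the bound 2 (e n + e k) is at most 4 e n, which must be less than
     [d ^+ 2]. *)
  have d4 : 0 < d ^+ 2 / 4 by rewrite divr_gt0 ?exprn_gt0.
  have [n _ /(_ n (leqnn n)) nP] := near_infty_natSinv_lt (PosNum d4).
  exists (u n); exists n => // k /= nk.
  rewrite -ball_normE /= (norm_lt_rdot Hnorm) //; apply: le_lt_trans (dist n k) _.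
  have : e k <= e n by rewrite lef_pV2 ?posrE ?ltr0n // ler_nat.
  by have nP' : e n < d ^+ 2 / 4 := nP; have := e0 n; lra.
exists x0 => h.
apply/eqP; rewrite -subr_eq0; apply: contraT => X0.
set X := f h - _ in X0; have X2 : 0 < X ^+ 2 by rewrite exprn_even_gt0.
(* [K - 1] collects the coefficients of the two errors below. Once |x0 - u n|^2 and [e n] are both
   less than X^2 / K, this gives X^2 <= (X^2 / K) (K - 1) < X^2. *)
pose K := 2 * `|C| * '[h, h] + 2 * '[B h, h] + 1.
have K0 : 0 < K.
  have := b0 h; have := mulr_ge0 (normr_ge0 C) (rdot_ge0 dot h); rewrite /K; lra.
have d0 : 0 < X ^+ 2 / K by rewrite divr_gt0.
have [n [n1 n2]] : exists n, '[x0 - u n, x0 - u n] < X ^+ 2 / K /\ e n < X ^+ 2 / K.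
  apply: (@filter_ex _ \oo); apply: filterI; first exact: (cvg_rdot Hnorm).
  exact: near_infty_natSinv_lt (PosNum d0).
have h1 : '[B (x0 - u n), h] ^+ 2 <= X ^+ 2 / K * (`|C| * '[h, h]).
  apply: (le_trans (rdot_CauchySchwarz _ _ _)); rewrite mulrA.
  apply: ler_wpM2r; first exact: rdot_ge0.
  apply: (le_trans (BC _)); apply: (@le_trans _ _ (`|C| * '[x0 - u n, x0 - u n])).
    by rewrite ler_wpM2r ?rdot_ge0 ?ler_norm.
  by rewrite mulrC ler_wpM2r // ltW.
have h2 : ('[B (u n), h] - f h) ^+ 2 <= X ^+ 2 / K * '[B h, h].
  by apply: (le_trans (dP n h)); rewrite ler_wpM2r // ltW.
have : X ^+ 2 <= X ^+ 2 / K * (K - 1).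
  have XE : X = - ('[B (x0 - u n), h] + ('[B (u n), h] - f h)).
    by rewrite /X (linear_funB Bl) !rdotE; ring.
  have : X ^+ 2 <= 2 * '[B (x0 - u n), h] ^+ 2 + 2 * ('[B (u n), h] - f h) ^+ 2.
    rewrite XE; have := sqr_ge0 ('[B (x0 - u n), h] - ('[B (u n), h] - f h)); lra.
  by rewrite /K addrK; lra.
have -> : X ^+ 2 / K * (K - 1) = X ^+ 2 - X ^+ 2 / K by field; rewrite gt_eqF.
by lra.
Qed.
End RieszRepresentation.

(** * Adjoints and Cayley transforms *)

Section Adjoints.
Context {R : realType} {H : completeNormedModType R[i]}.
Variable dot : {dot H for Num.conj}.
Hypothesis Hnorm : hilbert_norm dot.

Local Notation "'[ x , y ]" := (rdot dot x y).

Lemma dotC x y : dot x y = Num.conj (dot y x).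
Proof. by rewrite [LHS]hermC expr0 mul1r. Qed.

Lemma dotPl (a : R[i]) x y z : dot (a *: x + y) z = a * dot x z + dot y z.
Proof. by rewrite linearDl linearZl_LR. Qed.

Lemma dot_inj x y : (forall z, dot x z = dot y z) -> x = y.
Proof. by move=> e; apply: (@rdot_inj _ _ dot) => z; rewrite /rdot e. Qed.

Lemma is_adjointC (T S : H -> H) : is_adjoint dot T S -> is_adjoint dot S T.
Proof. by move=> TS x y; rewrite dotC -TS -dotC. Qed.

Lemma is_adjoint_rdot (T S : H -> H) x y : is_adjoint dot T S ->
  '[T x, y] = '[x, S y].
Proof. by move=> TS; rewrite /rdot TS. Qed.

Lemma rdot_is_adjoint (T S : H -> H) : linear T ->
  (forall x y, '[T x, y] = '[x, S y]) -> is_adjoint dot T S.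
Proof.
by move=> Tl TS x y; apply: dot_rdot; rewrite ?TS // -(linear_funZ Tl) TS.
Qed.

Lemma is_adjoint_linear (T S : H -> H) : is_adjoint dot T S -> linear S.
Proof.
by move=> /is_adjointC TS a x y; apply: dot_inj => z; rewrite dotPl !TS dotPl.
Qed.

Lemma is_adjoint_comp (T T' S S' : H -> H) : is_adjoint dot T T' ->
  is_adjoint dot S S' -> is_adjoint dot (T \o S) (S' \o T').
Proof. by move=> TT SS x y; rewrite /= TT SS. Qed.

Lemma is_adjoint_scale_add (a b : R[i]) (T T' S S' : H -> H) :
  is_adjoint dot T T' -> is_adjoint dot S S' ->
  is_adjoint dot (fun x => a *: T x + b *: S x)
    (fun x => Num.conj a *: T' x + Num.conj b *: S' x).
Proof.
move=> TT SS x y.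
by rewrite linearDl linearDr !linearZl_LR !linearZr_LR /= !conjCK TT SS.
Qed.

(** Cauchy-Schwarz applied to <T (S y), y> = |S y|^2 gives |S y|^4 <= C |S y|^2 |y|^2. *)
Lemma is_adjoint_bounded (T S : H -> H) : bounded_operator T ->
  is_adjoint dot T S -> bounded_operator S.
Proof.
move=> Tb TS; have [C C0 TC] := bounded_operator_rdot Hnorm Tb.
apply: (rdot_bounded_operator Hnorm (is_adjoint_linear TS) (C := C)) => y.
have [->|Sy0] := eqVneq '[S y, S y] 0; first by rewrite mulr_ge0 ?rdot_ge0.
have Sy : 0 < '[S y, S y] by rewrite lt_neqAle eq_sym Sy0 rdot_ge0.
rewrite -(ler_pM2l Sy) -expr2 -{1}(is_adjoint_rdot _ _ TS).
apply: (le_trans (rdot_CauchySchwarz _ _ _)); rewrite mulrCA mulrA.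
by rewrite ler_wpM2r ?rdot_ge0.
Qed.

Lemma bounded_adjoint (T : H -> H) : bounded_operator T ->
  exists2 S, bounded_operator S & is_adjoint dot T S.
Proof.
move=> Tb; have [C C0 TC] := bounded_operator_rdot Hnorm Tb.
have /choice[S SP] : forall y, exists z, forall x, '[T x, y] = '[z, x].
  (* Riesz representation of x |-> <T x, y>: the case where the form is the inner product itself. *)
  move=> y; apply: (@lax_milgram_symmetric _ _ _ Hnorm id 1 _ (C * '[y, y])) => //.
  - by move=> x; rewrite mul1r.
  - by move=> x z; rewrite (linear_funD Tb.1) rdotDl.
  - by move=> r x; rewrite (linear_funZ Tb.1) rdotZl.
  - by rewrite mulr_ge0 ?rdot_ge0.
  - move=> x; apply: (le_trans (rdot_CauchySchwarz _ _ _)).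
    by rewrite mulrAC ler_wpM2r ?rdot_ge0.
have TS : is_adjoint dot T S.
  by apply: (rdot_is_adjoint Tb.1) => x y; rewrite SP rdotC.
by exists S => //; exact: is_adjoint_bounded TS.
Qed.

(** Expansion gives injectivity and makes A' A coercive, so A' A x = y is solvable for every [y]. By
    normality A (A' x) = y as well, whence surjectivity. *)
Lemma normal_expanding_inverse (A A' : H -> H) : bounded_operator A ->
  is_adjoint dot A A' -> A \o A' = A' \o A ->
  (forall x, '[x, x] <= '[A x, A x]) ->
  exists K, [/\ bounded_operator K, K \o A = id & A \o K = id].
Proof.
move=> Ab AA Ac A1; have A'b := is_adjoint_bounded Ab AA.
have Aadj x y : '[A x, y] = '[x, A' y] by exact: is_adjoint_rdot.
have Bb : bounded_operator (A' \o A) by exact: bounded_operator_comp.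
have [C C0 BC] := bounded_operator_rdot Hnorm Bb.
have /choice[K AK] : forall y, exists x, A x = y.
  move=> y.
  have [||x xP] := @lax_milgram_symmetric _ _ _ Hnorm (A' \o A) C
    (fun h => '[y, h]) '[y, y] Bb.1 _ BC _ (fun _ _ => rdotDr _ _ _ _)
    (fun _ _ => rdotZr _ _ _ _) (rdot_ge0 _ _)
    (fun _ => rdot_CauchySchwarz _ _ _).
  - by move=> x z /=; rewrite -Aadj rdotC -Aadj rdotC.
  - by move=> x /=; rewrite rdotC -Aadj.
  exists (A' x); apply: (@rdot_inj _ _ dot) => h.
  by rewrite xP -[A (A' x)]/((A \o A') x) Ac.
have KA x : K (A x) = x.
  apply/eqP; rewrite -subr_eq0; apply/eqP/(rdot_eq0 (dot := dot))/eqP.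
  rewrite eq_le rdot_ge0 andbT (le_trans (A1 _)) //.
  by rewrite (linear_funB Ab.1) AK subrr rdot0l.
exists K; split; [|exact/funext|exact/funext].
apply: (rdot_bounded_operator Hnorm (C := 1)).
  by move=> a x y; rewrite -[LHS]KA -[in RHS](KA (_ + _)) Ab.1 !AK.
by move=> x; rewrite mul1r -{3 4}(AK x).
Qed.

(** With A = 1 - i T and A' = 1 + i T, both products are 1 + T^2 >= 1, so both factors are
    invertible, and W = A' K for K the inverse of A. Since A + A' = 2, also W = 2 K - 1; hence
    commuting with W, K, A and T are the same condition. *)
Lemma cayley_transform (T : H -> H) : bounded_operator T ->
  is_adjoint dot T T ->
  exists W Ws, unitary_with_adjoint dot W Ws /\
    forall P, linear P -> (P \o W = W \o P <-> P \o T = T \o P).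
Proof.
move=> Tb TT; set i := 'i%C : R[i].
have ii : i * i = -1 by rewrite -expr2 sqr_i.
have ic : Num.conj (- i) = i.
  by apply/eqP; rewrite eq_complex /= oppr0 opprK !eqxx.
have c1 : Num.conj (-1) = -1 :> R[i] by rewrite rmorphN1.
pose A x := 1 *: id x + (- i) *: T x.
pose A' x := 1 *: id x + i *: T x.
have Ab : bounded_operator A.
  by apply: bounded_operator_scale_add => //; exact: bounded_operator_id.
have AA : is_adjoint dot A A'.
  have := @is_adjoint_scale_add 1 (- i) id id T T (fun _ _ => erefl) TT.
  by rewrite conjC1 ic.
have A'b := is_adjoint_bounded Ab AA.
have TD := linear_funD Tb.1; have TZ := linear_funZ Tb.1.
have AA1 x : A (A' x) = x + T (T x).
  rewrite /A /A' !scale1r TD TZ scalerDr scalerA mulNr ii opprK scale1r.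
  by rewrite scaleNr addrA addrK.
have AA2 x : A' (A x) = x + T (T x).
  rewrite /A /A' !scale1r TD TZ scalerDr scalerA mulrN ii opprK scale1r.
  by rewrite scaleNr addrA subrK.
have A1 x : '[x, x] <= '[A x, A x].
  rewrite (is_adjoint_rdot _ _ AA) AA2 rdotDr lerDl -(is_adjoint_rdot _ _ TT).
  exact: rdot_ge0.
have A'1 x : '[x, x] <= '[A' x, A' x].
  rewrite (is_adjoint_rdot _ _ (is_adjointC AA)) AA1 rdotDr lerDl.
  by rewrite -(is_adjoint_rdot _ _ TT) rdot_ge0.
have AAc : A \o A' = A' \o A by apply/funext => x /=; rewrite AA1 AA2.
have [K [Kb KA AK]] := normal_expanding_inverse Ab AA AAc A1.
have [K' [K'b K'A AK']] :=
  normal_expanding_inverse A'b (is_adjointC AA) (esym AAc) A'1.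
have KAE x : K (A x) = x by exact: (congr1 (@^~ x) KA).
have AKE x : A (K x) = x by exact: (congr1 (@^~ x) AK).
have K'AE x : K' (A' x) = x by exact: (congr1 (@^~ x) K'A).
have AK'E x : A' (K' x) = x by exact: (congr1 (@^~ x) AK').
have KK : is_adjoint dot K K' by move=> x y; rewrite -{1}(AK'E y) -AA AKE.
have sumA x : A x + A' x = 2 *: x.
  by rewrite /A /A' scaleNr addrACA addNr addr0 -mulr2n -scaler_nat scale1r.
pose W x := 2 *: K x + (-1) *: id x.
pose Ws x := 2 *: K' x + (-1) *: id x.
have WE x : W x = A' (K x).
  by rewrite /W -sumA AKE scaleN1r addrAC subrr add0r.
have WsE x : Ws x = A (K' x).
  by rewrite /Ws -sumA AK'E scaleN1r addrK.
exists W, Ws; split.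
  split.
  - by apply: bounded_operator_scale_add => //; exact: bounded_operator_id.
  - by apply: bounded_operator_scale_add => //; exact: bounded_operator_id.
  - have := @is_adjoint_scale_add 2 (-1) K K' id id KK (fun _ _ => erefl).
    by rewrite c1 conjC_nat.
  - by apply/funext => x; rewrite /= WE WsE K'AE AKE.
  - by apply/funext => x; rewrite /= WE WsE KAE AK'E.
move=> P Pl; have PD := linear_funD Pl; have PZ := linear_funZ Pl.
split=> [PW|PT]; apply/funext => x /=.
- have PK y : P (K y) = K (P y).
    have := congr1 (@^~ y) PW; rewrite /= /W PD !PZ => /addIr.
    by apply: scalerI; rewrite pnatr_eq0.
  have PA : P (A x) = A (P x) by rewrite -[RHS]/(A (P x)) -{2}(KAE x) PK AKE.
  move: PA; rewrite /A PD !PZ => /addrI; apply: scalerI.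
  by rewrite oppr_eq0 -sqrf_eq0 expr2 ii oppr_eq0 oner_eq0.
- have PA y : P (A y) = A (P y).
    by rewrite /A PD !PZ (congr1 (@^~ y) PT : P (T y) = T (P y)).
  have PK y : P (K y) = K (P y) by rewrite -[LHS]KAE -PA AKE.
  by rewrite /W PD !PZ PK.
Qed.

End Adjoints.

(** * Von Neumann algebras *)

Lemma compC_at (T : Type) (P Q : T -> T) x : P \o Q = Q \o P -> P (Q x) = Q (P x).
Proof. by move=> PQ; rewrite -[LHS]/((P \o Q) x) PQ. Qed.

Section VonNeumannAlgebras.
Context {R : realType} {H : completeNormedModType R[i]}.
Variable dot : {dot H for Num.conj}.
Hypothesis Hnorm : hilbert_norm dot.
Variable N : set (H -> H).
Hypothesis HN : von_neumann_algebra dot N.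

Lemma vna_bounded T : N T -> bounded_operator T.
Proof. by rewrite -(vna_bicommutant HN) => -[]. Qed.

Lemma vna_comp S T : N S -> N T -> N (S \o T).
Proof.
rewrite -(vna_bicommutant HN) => -[Sb Sc] [Tb Tc].
split; first exact: bounded_operator_comp.
move=> W W'; apply/funext => x /=.
by rewrite (compC_at _ (Tc W W')) (compC_at _ (Sc W W')).
Qed.

Lemma vna_adjoint T S : N T -> is_adjoint dot T S -> N S.
Proof.
move=> /(vna_star HN)[S' NS' TS'] TS; suff -> : S = S' by [].
apply/funext => x; apply: (dot_inj (dot := dot)) => z.
by rewrite (is_adjointC TS) (is_adjointC TS').
Qed.

(** Take adjoints in the commutation of [T] with the adjoint of [M], which lies in [N] too. *)
Lemma commutant_adjoint T S : commutant N T -> is_adjoint dot T S ->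
  commutant N S.
Proof.
move=> [Tb Tc] TS; split; first exact: is_adjoint_bounded TS.
move=> M NM; have [M' NM' MM'] := vna_star HN NM.
apply/funext => x; apply: (dot_inj (dot := dot)) => z /=.
by rewrite (is_adjointC TS) MM' -(compC_at _ (Tc M' NM')) MM' (is_adjointC TS).
Qed.

Lemma commutant_scale_add (a b : R[i]) S T : commutant N S -> commutant N T ->
  commutant N (fun x => a *: S x + b *: T x).
Proof.
move=> [Sb Sc] [Tb Tc]; split; first exact: bounded_operator_scale_add.
move=> M NM; have Ml := (vna_bounded NM).1; apply/funext => x /=.
rewrite (linear_funD Ml) !(linear_funZ Ml).
by rewrite (compC_at _ (Sc M NM)) (compC_at _ (Tc M NM)).
Qed.

Lemma unitary_adjointC U Us : unitary_with_adjoint dot U Us ->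
  unitary_with_adjoint dot Us U.
Proof. by case=> Ub Usb UU UsU UUs; split=> //; exact: is_adjointC. Qed.

(* Cayley transforms supply enough unitaries in the commutant. *)
Lemma bicommutant_of_unitaries P : bounded_operator P ->
  (forall U Us, commutant N U -> unitary_with_adjoint dot U Us ->
     P \o U = U \o P) ->
  N P.
Proof.
move=> Pb PU; rewrite -(vna_bicommutant HN); split=> // T NT.
(* The Cayley transform of [X] commutes with all that commutes with [X], so it is in the commutant;
   commutation of [P] with it passes back to [X]. *)
have PX X : commutant N X -> is_adjoint dot X X -> P \o X = X \o P.
  move=> [Xb Xc] XX; have [W [Ws [WW WP]]] := cayley_transform Hnorm Xb XX.
  apply/(WP P Pb.1)/(PU W Ws) => //; split; first by case: WW.
  by move=> M NM; apply/esym/(WP M (vna_bounded NM).1)/esym/Xc.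
have [S Sb TS] := bounded_adjoint Hnorm NT.1.
have ST := is_adjointC TS; have NS := commutant_adjoint NT TS.
set i := 'i%C : R[i].
have ic : Num.conj i = - i by apply/eqP; rewrite eq_complex /= oppr0 !eqxx.
have iNc : Num.conj (- i) = i.
  by apply/eqP; rewrite eq_complex /= oppr0 opprK !eqxx.
have ii : i * i = -1 by rewrite -expr2 sqr_i.
(* With [S] the adjoint of [T], both T + S and i (T - S) are self-adjoint elements of the commutant,
   and T is half the sum of T + S and T - S. *)
have p1 x : P (T x + S x) = T (P x) + S (P x).
  have /PX : commutant N (fun x => 1 *: T x + 1 *: S x).
    exact: commutant_scale_add.
  move=> pX; have /pX /(compC_at x) : is_adjoint dot (fun x => 1 *: T x + 1 *: S x)
      (fun x => 1 *: T x + 1 *: S x).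
    by move=> y z; rewrite (is_adjoint_scale_add 1 1 TS ST) conjC1 [in RHS]addrC.
  by rewrite !scale1r.
have p2 x : P (i *: T x + (- i) *: S x) = i *: T (P x) + (- i) *: S (P x).
  have /PX : commutant N (fun x => i *: T x + (- i) *: S x).
    exact: commutant_scale_add.
  move=> pX; apply: (compC_at (Q := fun x => i *: T x + (- i) *: S x) x).
  apply: pX => y z.
  by rewrite (is_adjoint_scale_add i (- i) TS ST) ic iNc [in RHS]addrC.
have PD := linear_funD Pb.1; have PZ := linear_funZ Pb.1.
apply/funext => x /=; apply: (@scalerI _ _ (2 : R[i])); first by rewrite pnatr_eq0.
have i0 : i != 0 by rewrite -sqrf_eq0 expr2 ii oppr_eq0 oner_eq0.
have := p2 x; rewrite !scaleNr -!scalerBr PZ => /(scalerI i0) p3.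
have e (u v : H) : 2 *: u = (u + v) + (u - v).
  by rewrite addrACA subrr addr0 -mulr2n scaler_nat.
by rewrite (e (T (P x)) (S (P x))) -p1 -p3 PD (linear_funB Pb.1) -e.
Qed.

End VonNeumannAlgebras.

(** * Second moments of measures *)

Section MomentIntegrals.
Context {R : realType}.
Implicit Type mu : {measure set (measurableTypeR R) -> \bar R}.

Lemma measurable_sqr_EFin (A : set (measurableTypeR R)) :
  measurable_fun A (fun l : R => (l ^+ 2)%:E : \bar R).
Proof.
apply/measurable_EFinP; apply: measurable_funX.
exact: measurable_id.
Qed.

Lemma integrable_cst_finite mu (A : set (measurableTypeR R)) (k : R) :
  measurable A -> (mu setT < +oo)%E -> mu.-integrable A (EFin \o cst k).
Proof.
move=> mA muT; apply/integrableP; split; first exact/measurable_EFinP.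
rewrite (eq_integral (cst `|k|%:E)) // integral_cst //.
rewrite lte_mul_pinfty // ?lee_fin //; apply: le_lt_trans muT.
by rewrite le_measure ?inE.
Qed.

(** The identity is dominated by the integrable function 1 + l^2. *)
Lemma integrable_id_of_sqr mu : (mu setT < +oo)%E ->
  (\int[mu]_l (l ^+ 2)%:E < +oo)%E -> mu.-integrable setT (EFin \o id).
Proof.
move=> muT mu2.
have i2 : mu.-integrable setT (fun l : R => (l ^+ 2)%:E).
  apply/integrableP; split; first exact: measurable_sqr_EFin.
  under eq_integral => l _ do rewrite gee0_abs ?lee_fin ?sqr_ge0 //.
  by [].
have := integrableD measurableT (integrable_cst_finite 1 measurableT muT) i2.
apply: le_integrable => //; first by apply/measurable_EFinP; exact: measurable_id.
move=> l _ /=; rewrite lee_fin [leRHS]ger0_norm ?addr_ge0 ?sqr_ge0 //.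
have := sqr_ge0 (`|l| - 1); have := real_normK (num_real l).
by have := sqr_ge0 l; lra.
Qed.

Lemma integrable_id_bounds mu (A : set (measurableTypeR R)) : measurable A ->
  (mu setT < +oo)%E -> mu (~` A) = 0%E -> mu.-integrable setT (EFin \o id) ->
  (forall a, (forall l, A l -> a <= l) ->
     a * fine (mu setT) <= Rintegral mu setT id) /\
  (forall b, (forall l, A l -> l <= b) ->
     Rintegral mu setT id <= b * fine (mu setT)).
Proof.
move=> mA muT muA mui.
have muE : mu setT = mu A.
  by rewrite -(setvU A) measureU ?setICl //=; [rewrite muA add0e | exact: measurableC].
have mui' : mu.-integrable A (EFin \o id) by exact: integrableS mui.
have -> : Rintegral mu setT id = Rintegral mu A id.
  rewrite /Rintegral (negligible_integral (N := ~` A)) //; last exact: measurableC.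
  by rewrite setTD setCK.
rewrite muE; split=> c cA; rewrite -Rintegral_cst //; apply: le_Rintegral => //.
- exact: integrable_cst_finite.
- exact: integrable_cst_finite.
Qed.

Lemma integral_sqr_bounded mu (A : set (measurableTypeR R)) (M : R) :
  measurable A -> (mu setT < +oo)%E -> mu (~` A) = 0%E ->
  (forall l, A l -> `|l| <= M) -> (\int[mu]_l (l ^+ 2)%:E < +oo)%E.
Proof.
move=> mA muT muA AM.
rewrite (ge0_negligible_integral (N := ~` A)) //; last 3 first.
- exact: measurableC.
- exact: measurable_sqr_EFin.
- by move=> l _; rewrite lee_fin sqr_ge0.
rewrite setTD setCK.
apply: (@le_lt_trans _ _ (\int[mu]_(l in A) cst (M ^+ 2)%:E l)%E).
  apply: ge0_le_integral => //.
  - by move=> l _; rewrite lee_fin sqr_ge0.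
  - exact: measurable_sqr_EFin.
  - move=> l Al; rewrite lee_fin -real_normK ?num_real // ler_pXn2r ?nnegrE //.
      exact: AM.
    exact: le_trans (AM _ Al).
rewrite integral_cst // lte_mul_pinfty // ?lee_fin ?sqr_ge0 //.
by apply: le_lt_trans muT; rewrite le_measure ?inE.
Qed.

(** Meant for the scalar measures of [x], [E A x] and [x - E A x]: finite second moments decide
    domains, first moments give the quadratic form of [D]. *)
Lemma moments_add (m m1 m2 : {measure set (measurableTypeR R) -> \bar R}) :
  (forall A : set (measurableTypeR R), measurable A -> m A = (m1 A + m2 A)%E) ->
  (m setT < +oo)%E -> (\int[m]_l (l ^+ 2)%:E < +oo)%E ->
  [/\ (\int[m1]_l (l ^+ 2)%:E < +oo)%E, (\int[m2]_l (l ^+ 2)%:E < +oo)%E &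
      Rintegral m setT id = Rintegral m1 setT id + Rintegral m2 setT id].
Proof.
move=> mE mT m2i.
have eq_int f : (\int[m]_x f x)%E = (\int[measure_add m1 m2]_x f x)%E.
  apply: eq_measure_integral => A mA _; rewrite mE //.
  exact: (esym (measure_addE m1 m2 A)).
have s0 (l : R) : (0 <= (l ^+ 2)%:E :> \bar R)%E by rewrite lee_fin sqr_ge0.
have := m2i; rewrite eq_int ge0_integral_measure_add //; last exact: measurable_sqr_EFin.
have := mT; rewrite mE // => mT'.
have m1T : (m1 setT < +oo)%E by apply: le_lt_trans mT'; rewrite leeDl.
have m2T : (m2 setT < +oo)%E by apply: le_lt_trans mT'; rewrite leeDr.
move=> m2i'.
have m1s : (\int[m1]_l (l ^+ 2)%:E < +oo)%E.
  by apply: le_lt_trans m2i'; rewrite leeDl ?integral_ge0.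
have m2s : (\int[m2]_l (l ^+ 2)%:E < +oo)%E.
  by apply: le_lt_trans m2i'; rewrite leeDr ?integral_ge0.
have i1 := integrable_id_of_sqr m1T m1s; have i2 := integrable_id_of_sqr m2T m2s.
split=> //; rewrite /Rintegral eq_int integral_measure_add //.
by rewrite fineD //; exact: integrable_fin_num.
Qed.

End MomentIntegrals.

(** * Spectral measures *)

Section SpectralMeasures.
Context {R : realType} {H : completeNormedModType R[i]}.
Variable dot : {dot H for Num.conj}.
Hypothesis Hnorm : hilbert_norm dot.
Variable D : operator H.
Hypothesis HD : self_adjoint dot D.

Local Notation "'[ x , y ]" := (rdot dot x y).

Lemma self_adjoint_sym x y : opdom D x -> opdom D y ->
  '[opfun D x, y] = '[x, opfun D y].
Proof.
move=> Dx Dy; have [_ /(_ (conj Dy erefl))] := sa_adjoint HD y (opfun D y).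
by rewrite /rdot => ->.
Qed.

Lemma opdomZ a x : opdom D x -> opdom D (a *: x).
Proof.
by move=> Dx; have := sa_dom_linear HD a Dx (sa_dom0 HD); rewrite addr0.
Qed.

Lemma opdomD x y : opdom D x -> opdom D y -> opdom D (x + y).
Proof. by move=> Dx Dy; have := sa_dom_linear HD 1 Dx Dy; rewrite scale1r. Qed.

Lemma opfunD x y : opdom D x -> opdom D y ->
  opfun D (x + y) = opfun D x + opfun D y.
Proof. by move=> Dx Dy; have := sa_linear HD 1 Dx Dy; rewrite !scale1r. Qed.

Lemma opfun0 : opfun D 0 = 0.
Proof.
have := opfunD (sa_dom0 HD) (sa_dom0 HD); rewrite addr0 => /eqP.
by rewrite -subr_eq0 opprD addrA subrr sub0r oppr_eq0 => /eqP.
Qed.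

Lemma opfunZ a x : opdom D x -> opfun D (a *: x) = a *: opfun D x.
Proof.
by move=> Dx; have := sa_linear HD a Dx (sa_dom0 HD); rewrite !addr0 opfun0 addr0.
Qed.

(** A nonzero [z] would have a point [y] of the domain at distance less than |z|, whereas
    orthogonality gives |z - y|^2 = |z|^2 + |y|^2. *)
Lemma dense_rdot_eq0 z : (forall y, opdom D y -> '[z, y] = 0) -> z = 0.
Proof.
move=> zD; apply: contrapT => z0.
have zz : 0 < '[z, z].
  by rewrite lt_neqAle rdot_ge0 andbT; apply/eqP => /esym/rdot_eq0.
have e0 : 0 < Num.sqrt '[z, z] by rewrite sqrtr_gt0.
have [||y [zy Dy]] := sa_dense HD (O := ball z (Num.sqrt '[z, z])%:C%C).
- by exists z; apply: ballxx; rewrite ltcR.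
- by apply: ball_open; rewrite ltcR.
move: zy; rewrite -ball_normE /= (norm_lt_rdot Hnorm) // sqr_sqrtr ?rdot_ge0 //.
rewrite !rdotE (rdotC _ y z) (zD y Dy); have := rdot_ge0 dot y; lra.
Qed.

Section OneSpectralMeasure.
Variable E : set R -> H -> H.
Hypothesis HE : is_spectral_measure dot D E.
Implicit Types A B : set (measurableTypeR R).

Lemma spectral_linear A : measurable A -> linear (E A).
Proof. by move=> mA; have [[]] := pvm_projection HE.1 mA. Qed.

Lemma spectral_comp A B x : measurable A -> measurable B ->
  E A (E B x) = E (A `&` B) x.
Proof. by move=> mA mB; rewrite (pvm_setI HE.1 mA mB). Qed.

Lemma spectral_idem A x : measurable A -> E A (E A x) = E A x.
Proof. by move=> mA; rewrite spectral_comp // setIid. Qed.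

Lemma spectral_sym A x y : measurable A -> '[E A x, y] = '[x, E A y].
Proof.
by move=> mA; have [_ _ EA] := pvm_projection HE.1 mA; exact: is_adjoint_rdot.
Qed.

Lemma spectral_norm A x : measurable A -> '[E A x, E A x] = '[E A x, x].
Proof. by move=> mA; rewrite -spectral_sym // spectral_idem. Qed.

Lemma spectral_mass x : exists mu : {measure set (measurableTypeR R) -> \bar R},
  [/\ forall A, measurable A -> mu A = '[E A x, x]%:E,
      (mu setT < +oo)%E,
      fine (mu setT) = '[x, x],
      opdom D x <-> (\int[mu]_l (l ^+ 2)%:E < +oo)%E &
      opdom D x -> '[opfun D x, x] = Rintegral mu setT id].
Proof.
have [mu [muE muD muq]] := HE.2 x; exists mu.
have muT : mu setT = '[x, x]%:E by rewrite muE // (pvm_setT HE.1).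
split=> //; [by rewrite muT ltry | by rewrite muT |].
by move=> Dx; rewrite /rdot muq.
Qed.

Lemma spectral_set0 x : E set0 x = 0.
Proof.
have [mu [muE _ _ _ _]] := spectral_mass x; apply: (rdot_eq0 (dot := dot)).
by have := muE set0 measurable0; rewrite measure0 spectral_norm // => -[].
Qed.

(** The vectors [E A x] and [E (~] A) x[are orthogonal, and by additivity of the scalar measure
    their squared norms add up to |x|^2; so x - E A x - E (~] A) x has norm 0. *)
Lemma spectral_setC A x : measurable A -> E (~` A) x = x - E A x.
Proof.
move=> mA; have mC := measurableC mA; apply/esym/eqP; rewrite -subr_eq0.
apply/eqP/(rdot_eq0 (dot := dot)).
have [mu [muE _ muT _ _]] := spectral_mass x.
have : mu setT = (mu A + mu (~` A))%E by rewrite -measureU ?setUv ?setICr.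
rewrite !muE // (pvm_setT HE.1) => -[sumE].
have ab : '[E A x, E (~` A) x] = 0.
  by rewrite spectral_sym // spectral_comp // setICr spectral_set0 rdot0r.
have := spectral_norm x mA; have := spectral_norm x mC.
rewrite !rdotE (rdotC _ x (E A x)) (rdotC _ x (E (~` A) x)).
by rewrite (rdotC _ (E (~` A) x) (E A x)) ab; lra.
Qed.

(** A countable union of null sets of the scalar measure of [x] is null. This carries vanishing over
    from closed intervals to the rays that they exhaust. *)
Lemma spectral_bigcup A (B : nat -> set (measurableTypeR R)) x :
  measurable A -> (forall n, measurable (B n)) ->
  (forall l, A l -> exists n, B n l) -> (forall n, E (B n) x = 0) -> E A x = 0.
Proof.
move=> mA mB AB B0; have [mu [muE _ _ _ _]] := spectral_mass x.
have : mu.-negligible A.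
  have : mu.-negligible (\bigcup_n B n).
    apply: negligible_bigcup => n; apply/negligibleP => //.
    by have := muE _ (mB n); rewrite B0 rdot0l.
  by apply: negligibleS => l /AB[n Bnl]; exists n.
move=> /(negligibleP _ mA) muA0; have := muE A mA.
by rewrite [LHS]muA0 -spectral_norm // => -[] /esym/rdot_eq0.
Qed.

(** The cross terms between [u] and [x - u] vanish, so their scalar measures add up to that of [x],
    and [moments_add] applies. *)
Lemma spectral_split A x : measurable A -> opdom D x ->
  let u := E A x in
  [/\ opdom D u, opdom D (x - u) &
      '[opfun D x, x] = '[opfun D u, u] + '[opfun D (x - u), x - u]].
Proof.
move=> mA Dx u; have [m [mE mT _ mD mq]] := spectral_mass x.
have [m1 [m1E _ _ m1D m1q]] := spectral_mass u.
have [m2 [m2E _ _ m2D m2q]] := spectral_mass (x - u).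
have [||/m1D Du /m2D Dv q] := @moments_add _ m m1 m2 _ mT; last 1 first.
- by split=> //; rewrite mq // m1q // m2q.
- move=> B mB; rewrite mE // m1E // m2E //; congr (_%:E).
  have EB y z : '[E B (E A y), z] = '[E B y, E A z].
    by rewrite spectral_comp // setIC -spectral_comp // spectral_sym.
  rewrite (linear_funB (spectral_linear mB)) !rdotE !EB spectral_idem //.
  have := EB x x; rewrite -/u; lra.
- exact/mD.
Qed.

(** Splitting u + v shows that the form of [D] at u + v is the sum of its values at [u] and [v]; the
    cross term 2 <D u, v> is therefore 0. *)
Lemma spectral_cross A u v : measurable A -> opdom D u -> opdom D v ->
  E A u = u -> E A v = 0 -> '[opfun D u, v] = 0.
Proof.
move=> mA Du Dv Au Av; have [_ _] := spectral_split mA (opdomD Du Dv).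
rewrite (linear_funD (spectral_linear mA)) Au Av addr0 addrAC subrr add0r.
rewrite opfunD // !rdotE (self_adjoint_sym Dv Du) (rdotC _ v); lra.
Qed.

Lemma spectral_dom A x : measurable A -> opdom D x -> opdom D (E A x).
Proof. by move=> mA /(spectral_split mA)[]. Qed.

(** By [spectral_cross], <D E x, y> = <D E x, E y> = <D x, E y> = <E D x, y> for [y] in the dense
    domain, where E stands for [E A]. *)
Lemma spectral_commute A x : measurable A -> opdom D x ->
  opfun D (E A x) = E A (opfun D x).
Proof.
move=> mA Dx; apply/eqP; rewrite -subr_eq0; apply/eqP/dense_rdot_eq0 => y Dy.
have Al := spectral_linear mA.
have [Du Dv _] := spectral_split mA Dx; have [Dw Dz _] := spectral_split mA Dy.
have Av t : E A (t - E A t) = 0 by rewrite (linear_funB Al) spectral_idem ?subrr.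
have := spectral_cross mA Du Dz (spectral_idem _ mA) (Av _).
have := spectral_cross mA Dw Dv (spectral_idem _ mA) (Av _).
rewrite !rdotBr !rdotBl spectral_sym // (self_adjoint_sym Dw Dx).
rewrite (self_adjoint_sym Dw Du) (rdotC _ _ (opfun D x)) (rdotC _ _ (opfun D (E A x))).
lra.
Qed.

Lemma spectral_range_complement A x : measurable A -> E A x = x ->
  E (~` A) x = 0.
Proof. by move=> mA Ax; rewrite spectral_setC // Ax subrr. Qed.

Lemma spectral_bounded_dom A M x : measurable A ->
  (forall l, A l -> `|l| <= M) -> E A x = x -> opdom D x.
Proof.
move=> mA AM Ax; have [mu [muE muT _ -> _]] := spectral_mass x.
apply: (integral_sqr_bounded mA muT _ AM).
by rewrite muE ?spectral_range_complement ?rdot0l //; exact: measurableC.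
Qed.

Lemma spectral_form_bounds A x : measurable A -> opdom D x -> E A x = x ->
  (forall a, (forall l, A l -> a <= l) -> a * '[x, x] <= '[opfun D x, x]) /\
  (forall b, (forall l, A l -> l <= b) -> '[opfun D x, x] <= b * '[x, x]).
Proof.
move=> mA Dx Ax; have [mu [muE muT muX muD muq]] := spectral_mass x.
rewrite -muX muq //; apply: integrable_id_bounds => //.
  by rewrite muE ?spectral_range_complement ?rdot0l //; exact: measurableC.
by apply: integrable_id_of_sqr => //; exact/muD.
Qed.

End OneSpectralMeasure.
End SpectralMeasures.

(** * Uniqueness of the spectral measure *)

Section SpectralUniqueness.
Context {R : realType} {H : completeNormedModType R[i]}.
Variable dot : {dot H for Num.conj}.
Hypothesis Hnorm : hilbert_norm dot.
Variable D : operator H.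
Hypothesis HD : self_adjoint dot D.

Local Notation "'[ x , y ]" := (rdot dot x y).

Lemma geometric_domination (r s a b : R) : 0 <= r -> r < s ->
  (forall n, s ^+ n * a <= r ^+ n * b) -> a <= 0.
Proof.
move=> r0 rs ab; have s0 : 0 < s by exact: le_lt_trans rs.
have q1 : `|r / s| < 1.
  by rewrite ger0_norm ?divr_ge0 ?(ltW s0) // ltr_pdivrMr // mul1r.
have : (r / s) ^+ n * b @[n --> \oo] --> 0 * b by apply: cvgMl; exact: cvg_expr.
rewrite mul0r => lim0; apply: (cvgr_to_ge lim0); apply: nearW => n.
by rewrite expr_div_n mulrAC ler_pdivlMr ?exprn_gt0 // mulrC.
Qed.

Definition shifted (c : R) (x : H) : H := opfun D x - c%:C%C *: x.

Lemma shiftedDZ c (t : R) x y : opdom D x -> opdom D y ->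
  shifted c (x + t%:C%C *: y) = shifted c x + t%:C%C *: shifted c y.
Proof.
move=> Dx Dy; rewrite /shifted (opfunD HD) ?(opfunZ HD) //; last exact: (opdomZ HD).
by rewrite scalerDr scalerBr !scalerA [t%:C%C * _]mulrC opprD addrACA.
Qed.

Lemma shifted_sym c x y : opdom D x -> opdom D y ->
  '[shifted c x, y] = '[x, shifted c y].
Proof. by move=> Dx Dy; rewrite /shifted !rdotE (self_adjoint_sym HD). Qed.

(* Polarization: the numerical radius of a symmetric operator bounds its norm. *)
Lemma shifted_norm_le (X : set H) (c r : R) : 0 < r ->
  (forall (t : R) x y, X x -> X y -> X (x + t%:C%C *: y)) ->
  (forall x, X x -> opdom D x /\ X (shifted c x)) ->
  (forall x, X x -> `|'[shifted c x, x]| <= r * '[x, x]) ->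
  forall x, X x -> '[shifted c x, shifted c x] <= r ^+ 2 * '[x, x].
Proof.
move=> r0 XDZ XB Xr x Xx; set y := shifted c x.
have [Dx Xy] := XB x Xx; have [Dy Xz] := XB y Xy.
have yE : '[shifted c y, x] = '[y, y] by rewrite shifted_sym.
(* The form at x + t y minus the form at x - t y is 4 t |y|^2, and is at most r (2 |x|^2 + 2 t^2
   |y|^2). The choice t = 1/r turns this into |y|^2 <= r^2 |x|^2. *)
have /ler_normlP[_] := Xr _ (XDZ r^-1 x y Xx Xy).
have /ler_normlP[] := Xr _ (XDZ (- r^-1) x y Xx Xy).
rewrite !shiftedDZ // -/y; move: (shifted c y) yE => z yE; clearbody y.
rewrite !rdotE yE (rdotC _ x y) => h1 _ h2.
have : r^-1 * (4 * '[y, y]) <= r^-1 * (2 * r ^+ 2 * '[x, x] + 2 * '[y, y]).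
  have -> : r^-1 * (2 * r ^+ 2 * '[x, x] + 2 * '[y, y]) =
    2 * r * '[x, x] + 2 * r^-1 * '[y, y] by field; rewrite gt_eqF.
  have e : r * (r^-1 * (r^-1 * '[y, y])) = r^-1 * '[y, y] by field; rewrite gt_eqF.
  move: h1 h2; lra.
by rewrite ler_pM2l ?invr_gt0 //; lra.
Qed.

Lemma shifted_norm_ge (c s : R) x : 0 <= s -> s * '[x, x] <= '[shifted c x, x] ->
  s ^+ 2 * '[x, x] <= '[shifted c x, shifted c x].
Proof.
move=> s0 h; have [x0|x0] := eqVneq '[x, x] 0; first by rewrite x0 mulr0 rdot_ge0.
have xp : 0 < '[x, x] by rewrite lt_neqAle eq_sym x0 rdot_ge0.
rewrite -(ler_pM2r xp); apply: le_trans (rdot_CauchySchwarz _ _ _).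
rewrite -mulrA -expr2 -exprMn ler_pXn2r ?nnegrE ?mulr_ge0 ?rdot_ge0 //.
by apply: le_trans h; rewrite mulr_ge0 ?rdot_ge0.
Qed.

Section TwoSpectralMeasures.
Variables (E F : set R -> H -> H).
Hypothesis HE : is_spectral_measure dot D E.
Hypothesis HF : is_spectral_measure dot D F.


(* On the range of E [a - 2 r, a] the operator D - (a - r) is bounded by r, while
   on the range of F [b, +oo[ it is bounded below by r + b - a > r; iterating it
   separates the two ranges. *)
Lemma spectral_separation (a b r : R) x : 0 < r -> a < b ->
  F `[b, +oo[ (E `[a - 2 * r, a] x) = 0.
Proof.
(* [c] is the midpoint of [a - 2 r, a] and [s] its distance to [b]. *)
move=> r0 ab; pose c := a - r; pose s := b - c.
have rs : r < s by rewrite /s /c; lra.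
set A := `[a - 2 * r, a]%classic; set B := `[b, +oo[%classic.
have mA : measurable (A : set (measurableTypeR R)) by exact: measurable_itv.
have mB : measurable (B : set (measurableTypeR R)) by exact: measurable_itv.
have AE l : A l -> a - 2 * r <= l /\ l <= a.
  by rewrite /A /= in_itv /= => /andP[].
pose X : set H := [set x | E A x = x].
have EAl := spectral_linear HE mA.
have XDZ (t : R) y z : X y -> X z -> X (y + t%:C%C *: z).
  by rewrite /X /= (linear_funD EAl) (linear_funZ EAl) => -> ->.
have Xdom y : X y -> opdom D y.
  apply: (spectral_bounded_dom HE (A := A) (M := `|a| + 2 * r)) => // l /AE[l1 l2].
  by rewrite ler_norml; have := ler_norm a; have := lerNnormlW (lexx `|a|); lra.
have XB y : X y -> opdom D y /\ X (shifted c y).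
  move=> Xy; have Dy := Xdom y Xy; split=> //.
  rewrite /X /= /shifted (linear_funB EAl) (linear_funZ EAl).
  by rewrite -(spectral_commute Hnorm HD HE) // Xy.
have Xr y : X y -> `|'[shifted c y, y]| <= r * '[y, y].
  move=> Xy; have [lo up] := spectral_form_bounds HE mA (Xdom y Xy) Xy.
  have := lo (a - 2 * r) (fun l Al => (AE l Al).1).
  have := up a (fun l Al => (AE l Al).2).
  by rewrite ler_norml /shifted !rdotE /c => h1 h2; apply/andP; split; lra.
have XB2 := shifted_norm_le r0 XDZ XB Xr.
pose u n := iter n (shifted c) (E A x).
have Xu n : X (u n).
  by elim: n => [|n /XB[]//]; rewrite /X /u /= (spectral_idem HE).
have u_le n : '[u n, u n] <= (r ^+ 2) ^+ n * '[u 0, u 0].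
  elim: n => [|n IH]; first by rewrite expr0 mul1r.
  apply: (le_trans (XB2 _ (Xu n))); rewrite (exprS (r ^+ 2)) -mulrA.
  by rewrite ler_wpM2l // sqr_ge0.
have Fu n : F B (u n.+1) = shifted c (F B (u n)).
  have Du := Xdom _ (Xu n); have FBl := spectral_linear HF mB.
  rewrite /u /= -/(u n) /shifted (linear_funB FBl) (linear_funZ FBl).
  by rewrite (spectral_commute Hnorm HD HF).
(* [F B] commutes with D - c, so [F B (u n)] is the n-th iterate of D - c on [F B (u 0)], and each
   step expands norms by at least [s]. *)
have Fu_ge n : (s ^+ 2) ^+ n * '[F B (u 0), F B (u 0)] <= '[F B (u n), F B (u n)].
  elim: n => [|n IH]; first by rewrite expr0 mul1r.
  have Dv : opdom D (F B (u n)) by apply: (spectral_dom HF) => //; exact: Xdom.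
  rewrite Fu; apply: (@le_trans _ _ (s ^+ 2 * '[F B (u n), F B (u n)])).
    by rewrite (exprS (s ^+ 2)) -mulrA ler_wpM2l // sqr_ge0.
  apply: shifted_norm_ge; first by lra.
  have [lo _] := spectral_form_bounds HF mB Dv (spectral_idem HF _ mB).
  have := lo b; rewrite /shifted !rdotE /s => h.
  suff : b * '[F B (u n), F B (u n)] <= '[opfun D (F B (u n)), F B (u n)] by lra.
  by apply: h => l; rewrite /B /= in_itv /= andbT.
have F_le y : '[F B y, F B y] <= '[y, y].
  have := rdot_ge0 dot (y - F B y); rewrite !rdotE (rdotC _ y (F B y)).
  by rewrite (spectral_norm HF y mB); lra.
apply: (rdot_eq0 (dot := dot)); apply/eqP; rewrite eq_le rdot_ge0 andbT.
apply: (@geometric_domination (r ^+ 2) (s ^+ 2) _ '[u 0, u 0]).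
- exact: sqr_ge0.
- by rewrite ltr_pXn2r ?nnegrE //; lra.
- by move=> n; apply: (le_trans (Fu_ge n)); apply: (le_trans (F_le _)).
Qed.

(** The two products of projections are adjoint to each other, so they vanish together. *)
Lemma spectral_orthoC (A B : set (measurableTypeR R)) :
  measurable A -> measurable B -> (forall x, F B (E A x) = 0) ->
  forall x, E A (F B x) = 0.
Proof.
move=> mA mB FE x; apply: (rdot_eq0 (dot := dot)).
by rewrite (spectral_norm HE) // (spectral_sym HE) // (spectral_sym HF) // FE rdot0r.
Qed.

End TwoSpectralMeasures.

(** The intervals [a - 2 (n + 1), a] exhaust the ray of [E], and the rays [a + 1/(n + 1), +oo[
    exhaust the complement for [F], which removes the gap in [spectral_separation]. Since
    [spectral_bigcup] varies the outer projection only, the order is swapped in between. *)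
Lemma spectral_ray_le (E F : set R -> H -> H) (a : R) x :
  is_spectral_measure dot D E -> is_spectral_measure dot D F ->
  F `]-oo, a]%classic (E `]-oo, a]%classic x) = E `]-oo, a]%classic x.
Proof.
move=> HE HF.
have m (i : interval R) : measurable ([set` i] : set (measurableTypeR R)).
  exact: measurable_itv.
have EF b : a < b -> forall z, E `]-oo, a]%classic (F `[b, +oo[%classic z) = 0.
  move=> ab z.
  pose B n : set (measurableTypeR R) := `[a - 2 * (n.+1%:R : R), a]%classic.
  apply: (spectral_bigcup HE (B := B)) => //.
  - by move=> n; exact: m.
  - move=> l /=; rewrite in_itv /= => la; exists (Num.truncn (a - l)).
    rewrite /B /= in_itv /= la andbT.
    have := truncnS_gt (a - l); lra.
  - move=> n; apply: (spectral_orthoC HE HF (m _) (m _)) => y.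
    by apply: (spectral_separation HE HF) => //; rewrite ltr0n.
have FE b z : a < b -> F `[b, +oo[%classic (E `]-oo, a]%classic z) = 0.
  by move=> ab; apply: (spectral_orthoC HF HE (m _) (m _)); exact: EF.
have : F (~` `]-oo, a]%classic) (E `]-oo, a]%classic x) = 0.
  pose B n : set (measurableTypeR R) := `[a + n.+1%:R^-1, +oo[%classic.
  apply: (spectral_bigcup HF (B := B)); first exact: measurableC (m _).
  - by move=> n; exact: m.
  - move=> l /=; rewrite in_itv /= => /negP; rewrite -ltNge => la.
    have la0 : 0 < l - a by rewrite subr_gt0.
    have [n _ /(_ n (leqnn n)) /= nP] := near_infty_natSinv_lt (PosNum la0).
    by exists n; rewrite /B /= in_itv /= andbT -lerBrDl ltW.
  - by move=> n; apply: FE; rewrite ltrDl invr_gt0 ltr0n.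
by rewrite (spectral_setC HF) ?m // => /eqP; rewrite subr_eq0 => /eqP.
Qed.

(** Each range contains the other, and an orthogonal projection is determined by its range. *)
Lemma spectral_ray_unique (E F : set R -> H -> H) (a : R) :
  is_spectral_measure dot D E -> is_spectral_measure dot D F ->
  E `]-oo, a]%classic = F `]-oo, a]%classic.
Proof.
move=> HE HF; have mr : measurable (`]-oo, a]%classic : set (measurableTypeR R)).
  exact: measurable_itv.
apply/funext => x; apply: (@rdot_inj _ _ dot) => y.
rewrite -(spectral_ray_le a x HE HF) (spectral_sym HF) // (spectral_sym HE) //.
by rewrite (spectral_ray_le a y HF HE) (spectral_sym HF).
Qed.

Lemma spectral_itv_unique (E F : set R -> H -> H) (a b : R) :
  is_spectral_measure dot D E -> is_spectral_measure dot D F ->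
  E `]a, b]%classic = F `]a, b]%classic.
Proof.
move=> HE HF.
have m (i : interval R) : measurable ([set` i] : set (measurableTypeR R)).
  exact: measurable_itv.
have itvE : `]a, b]%classic = `]-oo, b]%classic `&` ~` `]-oo, a]%classic :> set R.
  apply/seteqP; split=> l /=; rewrite !in_itv /=.
    by move=> /andP[al lb]; split=> //; apply/negP; rewrite -ltNge.
  by move=> [lb /negP]; rewrite -ltNge => ->.
have G E' (HE' : is_spectral_measure dot D E') x :
    E' `]a, b]%classic x = E' `]-oo, b]%classic (x - E' `]-oo, a]%classic x).
  have mC := measurableC (m `]-oo, a]).
  by rewrite itvE -(spectral_comp HE') ?(spectral_setC HE') //; exact: m.
apply/funext => x; rewrite (G E HE) (G F HF).
by rewrite !(spectral_ray_unique _ HE HF).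
Qed.

End SpectralUniqueness.

(** * Unitary invariance *)

Section UnitaryInvariance.
Context {R : realType} {H : completeNormedModType R[i]}.
Variable dot : {dot H for Num.conj}.
Hypothesis Hnorm : hilbert_norm dot.

(** The scalar measure of [x] for the conjugated family is that of [Us x] for [E]. *)
Lemma spectral_measure_conj (D1 D0 : operator H) (U Us : H -> H)
    (E : set R -> H -> H) :
  unitary_with_adjoint dot U Us ->
  (forall x, opdom D1 x <-> opdom D0 (Us x)) ->
  (forall x, opdom D1 x -> opfun D1 x = U (opfun D0 (Us x))) ->
  is_spectral_measure dot D0 E ->
  is_spectral_measure dot D1 (fun A => U \o E A \o Us).
Proof.
move=> [Ub Usb UU UsU UUs] dom1 fun1 [[Eproj ET EI Esigma] Espec].
have UsUE x : Us (U x) = x by exact: (congr1 (@^~ x) UsU).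
split.
  split.
  - move=> A mA; have [Eb EE Eadj] := Eproj A mA; split.
    + by apply: bounded_operator_comp => //; exact: bounded_operator_comp.
    + apply/funext => x /=; rewrite UsUE; congr U.
      exact: (congr1 (@^~ (Us x)) EE).
    + by move=> x y; rewrite /= UU Eadj (is_adjointC UU).
  - by rewrite ET; exact: UUs.
  - by move=> A B mA mB; apply/funext => x; rewrite /= EI // UsUE.
  - move=> F mF tF x /=.
    under eq_fun do rewrite -(big_morph U (linear_funD Ub.1) (linear_fun0 Ub.1)).
    by apply: continuous_cvg; [exact: Ub.2|exact: Esigma].
move=> x; have [mu [muE muD muq]] := Espec (Us x); exists mu; split.
- by move=> A mA; rewrite /= UU muE.
- by rewrite dom1.
- by move=> Dx; rewrite fun1 // UU muq //; exact/dom1.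
Qed.

(** Both families are chosen by [xget], so only uniqueness relates them. The one of [D1] is
    conjugated back, because uniqueness is applied to [D0], which is self-adjoint. *)
Lemma spectral_projection_conj (D1 D0 : operator H) (U Us : H -> H) (a b : R) :
  self_adjoint dot D0 -> unitary_with_adjoint dot U Us ->
  (forall x, opdom D1 x <-> opdom D0 (Us x)) ->
  (forall x, opdom D1 x -> opfun D1 x = U (opfun D0 (Us x))) ->
  (exists E, is_spectral_measure dot D0 E) ->
  spectral_projection dot D1 `]a, b] =
  U \o spectral_projection dot D0 `]a, b] \o Us.
Proof.
move=> HD UU dom1 fun1 [E HE].
have [_ _ _ UsU UUs] := UU.
have HE0 : is_spectral_measure dot D0 (spectral_projection dot D0).
  exact: (xgetPex _ (P := is_spectral_measure dot D0)) (ex_intro _ E HE).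
have HE1 : is_spectral_measure dot D1 (spectral_projection dot D1).
  apply: (xgetPex _ (P := is_spectral_measure dot D1)).
  by exists (fun A => U \o E A \o Us); exact: (spectral_measure_conj UU).
have UsUE x : Us (U x) = x by exact: (congr1 (@^~ x) UsU).
have UUsE x : U (Us x) = x by exact: (congr1 (@^~ x) UUs).
have dom0 x : opdom D0 x <-> opdom D1 (U x) by rewrite dom1 UsUE.
have fun0 x : opdom D0 x -> opfun D0 x = Us (opfun D1 (U x)).
  by move=> /dom0 Dx; rewrite fun1 // !UsUE.
have HE2 := spectral_measure_conj (unitary_adjointC UU) dom0 fun0 HE1.
rewrite (spectral_itv_unique Hnorm HD a b HE0 HE2).
by apply/funext => x; rewrite /= !UUsE.
Qed.

Lemma no_spectral_projection (D : operator H) :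
  ~ (exists E, is_spectral_measure dot D E) ->
  spectral_projection dot D = (fun _ _ => 0).
Proof. by move=> nE; apply: xgetPN => E HE; apply: nE; exists E. Qed.

Variable N : set (H -> H).
Hypothesis HN : von_neumann_algebra dot N.

Lemma spectral_itv_vna (D : operator H) (E : set R -> H -> H) (a b : R) :
  self_adjoint dot D -> affiliated dot N D -> is_spectral_measure dot D E ->
  N (E `]a, b]%classic).
Proof.
move=> HD DN HE; have mab : measurable (`]a, b]%classic : set (measurableTypeR R)).
  exact: measurable_itv.
apply: (bicommutant_of_unitaries Hnorm HN).
  by have [] := pvm_projection HE.1 mab.
move=> W Ws NW WW; have [_ _ WadjWs WsW WWs] := WW.
have WsWE x : Ws (W x) = x by exact: (congr1 (@^~ x) WsW).
have WWsE x : W (Ws x) = x by exact: (congr1 (@^~ x) WWs).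
have NWs := commutant_adjoint Hnorm HN NW WadjWs.
(* Affiliation gives one inclusion for [Ws] and the converse one for [W]. *)
have dom x : opdom D x <-> opdom D (Ws x).
  split=> Dx; first by have [] := DN _ _ NWs (unitary_adjointC WW) x Dx.
  by have [] := DN _ _ NW WW _ Dx; rewrite WWsE.
have fund x : opdom D x -> opfun D x = W (opfun D (Ws x)).
  by move=> /dom Dx; have [_] := DN _ _ NW WW _ Dx; rewrite WWsE.
have HE' := spectral_measure_conj WW dom fund HE.
apply/funext => x; rewrite [in LHS](spectral_itv_unique Hnorm HD a b HE HE').
by rewrite /= WsWE.
Qed.

(** Traciality exchanges an operator with its adjoint; it is applied to U P, whose adjoint is P
    Us. *)
Lemma trace_unitary_conj (tau : (H -> H) -> \bar R) (P U Us : H -> H) :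
  faithful_normal_semifinite_trace dot N tau -> N P -> is_projection dot P ->
  N U -> unitary_with_adjoint dot U Us -> tau (U \o P \o Us) = tau P.
Proof.
move=> Htau NP [_ PP Padj] NU [_ _ UU UsU _].
have NUs := vna_adjoint HN NU UU.
have := trace_tracial Htau (vna_comp HN NU NP) (vna_comp HN NP NUs)
  (is_adjoint_comp UU Padj).
have -> : (P \o Us) \o (U \o P) = P.
  by rewrite compA -(compA P) UsU.
have -> : (U \o P) \o (P \o Us) = U \o P \o Us.
  by rewrite compA -(compA U) PP.
by [].
Qed.

End UnitaryInvariance.

Theorem theorem2p9 (R : realType) (H : completeNormedModType R[i])
    (dot : {dot H for Num.conj}) (Hnorm : hilbert_norm dot)
    (Hsep : @separable R H)
    (N : set (H -> H)) (HN : von_neumann_algebra dot N)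
    (tau : (H -> H) -> \bar R)
    (Htau : faithful_normal_semifinite_trace dot N tau)
    (D : operator H) (HDsa : self_adjoint dot D) (HDN : affiliated dot N D)
    (HDres : tau_compact_resolvent dot N tau D)
    (V : H -> H) (HVN : N V) (HVsa : is_adjoint dot V V)
    (Hequiv : unitarily_equivalent_in dot N (add_bounded D V) D)
    (xi : R -> R) (Hxi : is_spectral_shift_function dot N tau D V xi) :
  exists c : R, forall l : R, xi l = c.
Proof.
have [U [Us [NU UU dom1 fun1]]] := Hequiv.
have tauE a b : tau (spectral_projection dot (add_bounded D V) `]a, b]) =
                tau (spectral_projection dot D `]a, b]).
  have [[E HE]|nE] := pselect (exists E, is_spectral_measure dot D E).
    rewrite (spectral_projection_conj Hnorm a b HDsa UU dom1 fun1); last by exists E.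
    have HE0 : is_spectral_measure dot D (spectral_projection dot D).
      exact: (xgetPex _ (P := is_spectral_measure dot D)) (ex_intro _ E HE).
    apply: (trace_unitary_conj HN Htau) => //.
      exact: (spectral_itv_vna Hnorm HN a b HDsa HDN HE0).
    by apply: (pvm_projection HE0.1); exact: measurable_itv.
  rewrite !no_spectral_projection // => -[E HE]; apply: nE.
  have [_ _ _ UsU _] := UU.
  have UsUE x : Us (U x) = x by exact: (congr1 (@^~ x) UsU).
  exists (fun A => Us \o E A \o U).
  apply: (spectral_measure_conj (unitary_adjointC UU)) HE.
    by move=> x; rewrite dom1 UsUE.
  by move=> x Dx; rewrite fun1 ?UsUE //; apply/dom1; rewrite UsUE.
(* The base point 0 is arbitrary. As the counting functions agree, [g] is constant, so every point
   is a continuity point and [xi] equals [g] there. *)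
have [c /= cP] := Hxi.2 0.
pose g t := spectral_counting dot tau D 0 t -
  spectral_counting dot tau (add_bounded D V) 0 t + c.
have gE : g = cst c.
  by apply/funext => t; rewrite /g /spectral_counting !tauE subrr add0r.
exists c => l; have [+ _] := cP l; rewrite -/g -/(g l) gE => ->; first by [].
exact: cst_continuous.
Qed.
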